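(* The optimal density of a $(4,1)$ broadcast for $H_{\infty,\infty}$ satisfies \[\delta_{4,1}(H_{\infty,\infty})\leq \frac{1}{12}.\]
   Context: The infinite truncated square tiling graph $H_{\infty,\infty}$ has vertex set $\{(a,(x,y)) : a\in\mathbb{Z}_4,\ (x,y)\in\mathbb{Z}^2\}$. Its edges are: $(a,(x,y))\sim(a+1,(x,y))$ with $a+1$ taken modulo 4 (so each $(x,y)$ carries a 4-cycle whose vertices $0,1,2,3$ are its top, right, bottom, left vertices); $(1,(x,y))\sim(3,(x+1,y))$; and $(0,(x,y))\sim(2,(x,y+1))$. For $(x,y)\in\mathbb{Z}^2$ the octagon $O_{x,y}$ is the 8-cycle through $(0,(x,y)),(1,(x,y)),(3,(x+1,y)),(0,(x+1,y)),(2,(x+1,y+1)),(3,(x+1,y+1)),(1,(x,y+1)),(2,(x,y+1))$, in this cyclic order. For a graph $G$ and integers $1\le r\le t$, a set $T\subseteq V(G)$ is a $(t,r)$ broadcast of $G$ if every $u\in V(G)$ satisfies $\sum_{v\in T,\ d(u,v)<t}(t-d(u,v))\ge r$, where $d$ is the graph distance in $G$. The broadcast density of a $(t,r)$ broadcast $T$ for $H_{\infty,\infty}$ is $\lim_{n\to\infty}|T\cap V(B_n)|/|V(B_n)|$, where $B_n$ is the finite portion of the graph given by the union of the octagons $O_{x,y}$ with $-n\le x,y\le n-1$. The optimal density $\delta_{t,r}(H_{\infty,\infty})$ is the minimum (infimum) of the broadcast densities over all $(t,r)$ broadcasts $T$ of $H_{\infty,\infty}$ for which the limit exists. *)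

(* Defs.v *)
From mathcomp Require Import all_boot all_order all_algebra.
From mathcomp Require Import finmap.
From mathcomp Require Import all_classical all_reals all_analysis.
Set Implicit Arguments.
Unset Strict Implicit.
Unset Printing Implicit Defensive.
Import Order.TTheory GRing.Theory Num.Theory.
Import numFieldNormedType.Exports.
Local Open Scope classical_set_scope.
Local Open Scope ring_scope.

(* +oo when no walk joins u to v *)
Definition graph_dist (R : realType) (V : eqType) (adj : rel V) (u v : V) :
    \bar R :=
  ereal_inf [set (size p)%:R%:E
            | p in [set p : seq V | path adj u p /\ last u p = v]].

(* The sum is taken in \bar R so that it makes sense even when infinitely many
   elements of T lie within distance t of u. *)
Definition is_broadcast (R : realType) (V : choiceType) (adj : rel V)
    (t r : nat) (T : set V) : Prop :=
  forall u : V,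
    (r%:R%:E <=
       \esum_(v in [set v | T v /\ graph_dist R adj u v < t%:R%:E])
          (t%:R%:E - graph_dist R adj u v))%E.

Notation tst_vertex := ('Z_4 * (int * int))%type.

Definition tst_arc (u v : tst_vertex) : bool :=
  let: (a, (x, y)) := u in
  [|| v == (a + 1, (x, y)),
      (a == 1) && (v == (3, (x + 1, y)))
    | (a == 0) && (v == (2, (x, y + 1)))].

Definition tst_adj : rel tst_vertex := fun u v => tst_arc u v || tst_arc v u.

Definition octagon (x y : int) : seq tst_vertex :=
  [:: (0, (x, y)); (1, (x, y)); (3, (x + 1, y)); (0, (x + 1, y));
      (2, (x + 1, y + 1)); (3, (x + 1, y + 1)); (1, (x, y + 1));
      (2, (x, y + 1))].

Definition octagon_block (n : nat) : set tst_vertex :=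
  \bigcup_(p in [set p : int * int | - n%:Z <= p.1 <= n%:Z - 1 /\
                                     - n%:Z <= p.2 <= n%:Z - 1])
    [set` octagon p.1 p.2].

Definition has_density (R : realType) (T : set tst_vertex) (delta : R) : Prop :=
  (#|` fset_set (T `&` octagon_block n)|%:R
     / #|` fset_set (octagon_block n)|%:R : R) @[n --> \oo] --> delta.

(* Infimum in \bar R: it is +oo, and not 0, over an empty set of densities. *)
Definition optimal_density (R : realType) (t r : nat) : \bar R :=
  ereal_inf [set delta%:E | delta in
    [set delta : R | exists2 T : set tst_vertex,
       is_broadcast R tst_adj t r T & has_density T delta]].

(* Main.v *)
Require Import Defs.
From mathcomp Require Import all_boot all_order all_algebra.
From mathcomp Require Import finmap zify ring lra.
From mathcomp Require Import all_classical all_reals all_analysis.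
Import Order.TTheory GRing.Theory Num.Theory.
Local Open Scope ring_scope.

(** Put a transmitter (a tower) on the top vertex of every 4-cycle (cell) (x, y)
with x + y divisible by 3. Walking at most 3 edges, a tower reaches the four
vertices of its own cell and of the cell above it, all but the left vertex of
the cell on its left, and the left vertex of the cell diagonally above on its
right, among others. Classify a cell by x + y modulo 3. A cell of class 0
contains a tower, a cell of class 1 lies above a cell with a tower, and a cell
of class 2 lies both to the left of one and diagonally above, on the right, of
another. So every vertex is at distance at most 3 from a tower
([tower_near]), and hears it with strength at least 4 - 3 = 1
([broadcast_of_walks]).

Towers occupy one vertex in twelve. To get the limit, describe the block B_n as
the disjoint union of four rectangles of cells, one for each position in the
4-cycle ([octagon_blockE]); each has 2n (2n + 1) cells. All the towers lie in
the rectangle of top vertices, and each of its 2n rows has one tower every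
three cells, up to an error of at most 2/3 of a tower per row
([count_tower_rect]). The total error is linear in n, and the block has
quadratically many vertices, so the proportion of towers tends to 1/12
([tower_density]). *)

(** * Broadcasts from short walks *)

Lemma graph_dist_le_walk (R : realType) {V : eqType} {adj : rel V} {u : V}
    {p : seq V} :
  path adj u p -> (graph_dist R adj u (last u p) <= (size p)%:R%:E)%E.
Proof. by move=> up; apply: ereal_inf_lbound; exists p. Qed.

(** The broadcast sum is a supremum over finite sets of transmitters, so the
contribution of a single one already bounds it from below. Walks give only upper
bounds on distances, which is the direction needed here. *)
Lemma broadcast_of_walks (R : realType) {V : choiceType} {adj : rel V}
    {t r : nat} {T : set V} :
  (0 < r)%N ->
  (forall u, exists p : seq V,
     [/\ path adj u p, T (last u p) & size p + r <= t]%N) ->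
  is_broadcast R adj t r T.
Proof.
move=> r0 walk u; have [p [up Tp pt]] := walk u.
have dp := graph_dist_le_walk R up.
apply: esum_ge; exists [set last u p]%classic.
  split=> [|_ ->]; first exact: finite_set1.
  split=> //; apply: le_lt_trans dp _.
  by rewrite lte_fin ltr_nat; apply: leq_trans pt; rewrite -addn1 leq_add2l.
rewrite fsbig_set1; apply: le_trans (leeB (lexx _) dp).
by rewrite -EFinB lee_fin lerBrDr -natrD ler_nat addnC.
Qed.

(** * Covering the graph by towers *)

Definition tower (v : tst_vertex) : bool :=
  (v.1 == 0) && (3 %| v.2.1 + v.2.2)%Z.

Lemma Z4_cases (a : 'Z_4) : [\/ a = 0, a = 1, a = 2 | a = 3].
Proof.
by case: a => -[|[|[|[|//]]]] i;
  [constructor 1|constructor 2|constructor 3|constructor 4]; apply: val_inj.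
Qed.

(** Each walk is chosen according to the class of x + y modulo 3 and to the
position in the cell. Leaving a cell through its bottom vertex leads directly to
the tower of the cell below; entering the cell on the right is through its left
vertex, which is next to its tower. *)
Lemma tower_near (u : tst_vertex) :
  exists p : seq tst_vertex,
    [/\ path tst_adj u p, tower (last u p) & size p + 1 <= 4]%N.
Proof.
case: u => a [x y].
have : [\/ (3 %| x + y)%Z, (3 %| x + (y - 1))%Z | (3 %| x + 1 + y)%Z].
  have : [|| (3 %| x + y)%Z, (3 %| x + (y - 1))%Z | (3 %| x + 1 + y)%Z] by lia.
  by case/or3P; [constructor 1|constructor 2|constructor 3].
pose at_cell (i j : int) (b : 'Z_4) : tst_vertex := (b, (i, j)).
case=> h; case: (Z4_cases a) => ->.
- by exists [::].
- exists [:: at_cell x y 0].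
  by rewrite /tower /tst_adj /tst_arc /= !xpair_eqE !eqxx.
- exists [:: at_cell x y 1; at_cell x y 0].
  by rewrite /tower /tst_adj /tst_arc /= !xpair_eqE !eqxx.
- exists [:: at_cell x y 0].
  by rewrite /tower /tst_adj /tst_arc /= !xpair_eqE !eqxx.
- exists [:: at_cell x y 1; at_cell x y 2; at_cell x (y - 1) 0].
  by rewrite /tower /tst_adj /tst_arc /= !xpair_eqE subrK !eqxx.
- exists [:: at_cell x y 2; at_cell x (y - 1) 0].
  by rewrite /tower /tst_adj /tst_arc /= !xpair_eqE subrK !eqxx.
- exists [:: at_cell x (y - 1) 0].
  by rewrite /tower /tst_adj /tst_arc /= !xpair_eqE subrK !eqxx.
- exists [:: at_cell x y 2; at_cell x (y - 1) 0].
  by rewrite /tower /tst_adj /tst_arc /= !xpair_eqE subrK !eqxx.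
- exists [:: at_cell x y 1; at_cell (x + 1) y 3; at_cell (x + 1) y 0].
  by rewrite /tower /tst_adj /tst_arc /= !xpair_eqE !eqxx.
- exists [:: at_cell (x + 1) y 3; at_cell (x + 1) y 0].
  by rewrite /tower /tst_adj /tst_arc /= !xpair_eqE !eqxx.
- exists [:: at_cell x y 1; at_cell (x + 1) y 3; at_cell (x + 1) y 0].
  by rewrite /tower /tst_adj /tst_arc /= !xpair_eqE !eqxx.
(* The left vertex is 4 steps away from the tower of the cell on its right; the
   cell diagonally below on the left is also in residue class 0. *)
- have h' : (3 %| x - 1 + (y - 1))%Z by lia.
  exists [:: at_cell (x - 1) y 1; at_cell (x - 1) y 2;
             at_cell (x - 1) (y - 1) 0].
  by rewrite /tower /tst_adj /tst_arc /= !xpair_eqE !subrK !eqxx.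
Qed.

(** * Counting towers in a rectangle of cells *)

(** Locked, so that rewriting rules on concatenations do not see through it: an
explicit enumeration of products unfolds to nested concatenations. *)
Definition rect (a : 'Z_4) (x0 y0 : int) (m k : nat) : seq tst_vertex :=
  locked [seq (a, (x0 + i%:Z, y0 + j%:Z)) | j <- iota 0 k, i <- iota 0 m].

Lemma mem_rect a x0 y0 m k b x y :
  ((b, (x, y)) \in rect a x0 y0 m k) =
  [&& b == a, x0 <= x < x0 + m%:Z & y0 <= y < y0 + k%:Z].
Proof.
rewrite /rect -lock.
apply/allpairsP/and3P => [[[j i] /= [jk im [-> -> ->]]]|[/eqP-> hx hy]].
  by move: jk im; rewrite !mem_iota; split=> //; lia.
exists (`|y - y0|%N, `|x - x0|%N); rewrite /= !mem_iota.
split; [lia|lia|]; congr (_, (_, _)); lia.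
Qed.

Lemma rect_uniq a x0 y0 m k : uniq (rect a x0 y0 m k).
Proof.
rewrite /rect -lock; apply: allpairs_uniq; rewrite ?iota_uniq// =>
  -[j i] [j' i'] _ _ /= [].
by move=> /addrI[->] /addrI[->].
Qed.

Lemma size_rect a x0 y0 m k : size (rect a x0 y0 m k) = (k * m)%N.
Proof. by rewrite /rect -lock size_allpairs !size_iota. Qed.

(** Of three consecutive integers exactly one is divisible by 3, so the count
grows by 1 every three steps; the remaining at most two terms give the error. *)
Lemma count_dvd3_iota (c : int) (s m : nat) :
  (m <= 3 * count (fun i : nat => (3 %| (c + i%:Z)%R)%Z) (iota s m) + 2)%N /\
  (3 * count (fun i : nat => (3 %| (c + i%:Z)%R)%Z) (iota s m) <= m + 2)%N.
Proof.
elim/ltn_ind: m s => -[|[|[|m]]] IH s /=.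
- by [].
- by case: (3 %| _)%Z.
- by case h0: (3 %| _)%Z; case h1: (3 %| _)%Z => //; lia.
move: (IH m (ltnW (ltnW (ltnSn _))) s.+3); move: (count _ _) => K [].
case h0: (3 %| _)%Z; case h1: (3 %| _)%Z; case h2: (3 %| _)%Z; lia.
Qed.

Lemma count_tower_rect x0 y0 m k :
  (k * m <= 3 * count tower (rect 0%R x0 y0 m k) + 2 * k)%N /\
  (3 * count tower (rect 0%R x0 y0 m k) <= k * m + 2 * k)%N.
Proof.
rewrite /rect -lock.
pose row j := [seq (0 : 'Z_4, (x0 + i%:Z, y0 + j%:Z)) | i <- iota 0 m].
suff rows s : (size s * m <= 3 * count tower (flatten (map row s)) + 2 * size s)%N /\
    (3 * count tower (flatten (map row s)) <= size s * m + 2 * size s)%N.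
  by have := rows (iota 0 k); rewrite size_iota.
elim: s => [|j s IH] //=.
rewrite count_cat count_map.
have -> : count (preim (fun i : nat => (0, (x0 + i%:Z, y0 + j%:Z))) tower)
    (iota 0 m) = count (fun i : nat => (3 %| x0 + y0 + j%:Z + i%:Z)%Z) (iota 0 m).
  apply: eq_count => i /=; rewrite /tower /=; congr (_ %| _)%Z; lia.
have := count_dvd3_iota (x0 + y0 + j%:Z) 0 m.
move: IH; move: (count _ _) (count _ _) => K K'; lia.
Qed.

Lemma count_tower_rect_neq0 a x0 y0 m k :
  a != 0 -> count tower (rect a x0 y0 m k) = 0%N.
Proof.
move=> a0; apply/eqP; rewrite -leqn0 leqNgt -has_count.
by rewrite /rect -lock; apply/hasPn => _ /allpairsP[[j i] [_ _ ->]];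
  rewrite /tower /= (negPf a0).
Qed.

(** * The octagon block and its density of towers *)

(** A vertex lies on two octagons. Top vertices lie on those to the left and to
the right above their cell, so the row above y = n - 1 is missing for them;
similarly each other position misses the one side of the square on which its
octagons fall outside of the block. *)
Definition block_seq (n : nat) : seq tst_vertex :=
  rect 0 (- n%:Z) (- n%:Z) n.*2.+1 n.*2 ++
  rect 1 (- n%:Z) (- n%:Z) n.*2 n.*2.+1 ++
  rect 2 (- n%:Z) (1 - n%:Z) n.*2.+1 n.*2 ++
  rect 3 (1 - n%:Z) (- n%:Z) n.*2 n.*2.+1.

Lemma block_seq_uniq n : uniq (block_seq n).
Proof.
rewrite /block_seq !cat_uniq !rect_uniq !andTb !andbT -!all_predC.
apply/and3P; split; apply/allP => -[b [x y]];
  rewrite ?mem_cat !mem_rect /= ?mem_rect; by case: (Z4_cases b) => ->.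
Qed.

Lemma octagon_blockE n : (octagon_block n = [set` block_seq n])%classic.
Proof.
apply/seteqP; split=> -[b [x y]] /=; rewrite /block_seq !mem_cat !mem_rect.
  case=> -[i j] /= [hi hj]; rewrite !inE !xpair_eqE.
  by case: (Z4_cases b) => -> /=; lia.
(* Of the two octagons through the vertex, one may stick out of the block on the
   far side: the minimum selects the other one there. *)
pose i := Num.min x (n%:Z - 1); pose j := Num.min y (n%:Z - 1).
case: (Z4_cases b) => -> /= h.
- by exists (i, y); rewrite /= ?inE ?xpair_eqE /=; lia.
- by exists (x, j); rewrite /= ?inE ?xpair_eqE /=; lia.
- by exists (i, y - 1); rewrite /= ?inE ?xpair_eqE /=; lia.
- by exists (x - 1, j); rewrite /= ?inE ?xpair_eqE /=; lia.
Qed.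

Lemma card_fset_set_seq {T : choiceType} {s : seq T} :
  uniq s -> #|` fset_set [set` s]%classic| = size s.
Proof.
move=> us; rewrite -{2}(undup_id us) -card_fseq; congr (#|` _ |).
by apply/fsetP => v; rewrite in_fset_set ?inE//= ; apply/idP/idP; rewrite inE.
Qed.

Lemma card_octagon_block n :
  #|` fset_set (octagon_block n)| = (8 * n * n.*2.+1)%N.
Proof.
rewrite octagon_blockE card_fset_set_seq ?block_seq_uniq//.
by rewrite /block_seq !size_cat !size_rect; lia.
Qed.

Lemma card_tower_block n :
  #|` fset_set ([set v | tower v] `&` octagon_block n)%classic| =
  count tower (rect 0 (- n%:Z)%R (- n%:Z)%R n.*2.+1 n.*2).
Proof.
have -> : ([set v | tower v] `&` octagon_block n =
    [set` [seq v <- block_seq n | tower v]])%classic.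
  rewrite octagon_blockE; apply/seteqP; split=> v /=; rewrite mem_filter.
    by case=> -> ->.
  by case/andP.
rewrite card_fset_set_seq ?filter_uniq ?block_seq_uniq// size_filter.
by rewrite /block_seq !count_cat (count_tower_rect_neq0 1)//
  (count_tower_rect_neq0 2)//
  (count_tower_rect_neq0 3)// !addn0.
Qed.

(** By [count_tower_rect], 12 times the number of towers differs from the number
8 n (2 n + 1) of vertices by at most 16 n, so the ratio is within
1 / (6 (2 n + 1)) of 1 / 12; the bound 1 / (n + 1) is weaker but is a sequence
known to tend to 0. *)
Lemma tower_density (R : realType) :
  @has_density R [set v | tower v]%classic (1 / 12).
Proof.
apply: (@squeeze_cvgr _ _ _ _ (fun n => 1 / 12 - harmonic n : R)
  (fun n => 1 / 12 + harmonic n : R)).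
- near=> n; rewrite card_octagon_block card_tower_block.
  have [lo hi] := count_tower_rect (- n%:Z) (- n%:Z) n.*2.+1 n.*2.
  set c := count _ _ in lo hi *.
  have n0 : (0 < n)%N by near: n; exact: nbhs_infty_gt.
  set N : R := n%:R; set D : R := (8 * n * n.*2.+1)%:R; set q := harmonic n.
  have DE : D = 8 * N * (2 * N + 1).
    by rewrite /D -muln2 -[(n * 2).+1]addn1 !natrM natrD natrM /N; ring.
  have N0 : 0 < N by rewrite ltr0n.
  have D0 : 0 < D by rewrite DE; nra.
  have q0 : 0 < q by exact: harmonic_gt0.
  have qN : q * (N + 1) = 1 by rewrite /q /= natr1 mulVf.
  have qD : 8 * N <= q * D.
    have -> : q * D = 8 * N * (q * (N + 1)) + 8 * N * N * q by rewrite DE; ring.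
    by rewrite qN; nra.
  have lo' : D <= 12 * c%:R + 16 * N.
    by rewrite /D /N -!natrM -natrD ler_nat; lia.
  have hi' : 12 * c%:R <= D + 16 * N.
    by rewrite /D /N -!natrM -natrD ler_nat; lia.
  by rewrite ler_pdivlMr// ler_pdivrMr// mulrBl mulrDl; apply/andP; split; lra.
- rewrite -{2}[1 / 12]subr0.
  by apply: cvgB; [exact: cvg_cst|exact: cvg_harmonic].
- rewrite -{2}[1 / 12]addr0.
  by apply: cvgD; [exact: cvg_cst|exact: cvg_harmonic].
Unshelve. all: by end_near. Qed.

Theorem theorem4p8 (R : realType) :
  (optimal_density R 4 1 <= (1 / 12)%:E)%E.
Proof.
apply: ereal_inf_lbound; exists (1 / 12) => //; exists [set v | tower v]%classic.
  by apply: broadcast_of_walks => // u; exact: tower_near.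
exact: tower_density.
Qed.
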